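(* For every graphon $W$ and every $\epsilon>0$, $$\lim_{n\to\infty}\Pr\left[\,\left|\frac{\omega(\mathbb G(n,W))}{\mathbb E[\omega(\mathbb G(n,W))]}-1\right|>\epsilon\,\right]=0 .$$
   Context: A graphon is a symmetric measurable function $W:\Omega^2\to[0,1]$, where $\Omega$ is an atomless standard Borel probability space with probability measure $\nu$. The random graph $\mathbb G(n,W)$ has vertex set $\{1,\dots,n\}$: sample $x_1,\dots,x_n\in\Omega$ independently according to $\nu$, then join $i\neq j$ by an edge independently with probability $W(x_i,x_j)$. $\omega(G)$ denotes the clique number of a graph $G$. *)

(* Defs.v *)
From HB Require Import structures.
From mathcomp Require Import all_boot all_order all_algebra.
From mathcomp Require Import all_classical all_reals all_analysis.
From mathcomp Require Import measurable_realfun.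

Set Implicit Arguments.
Unset Strict Implicit.
Unset Printing Implicit Defensive.
Import Order.TTheory GRing.Theory Num.Theory.
Import numFieldNormedType.Exports.

Local Open Scope classical_set_scope.
Local Open Scope ring_scope.

Definition polish (R : realType) (S : metricType R) : Prop :=
  (forall F : set_system S, ProperFilter F -> cauchy F ->
     exists x : S, F --> x) /\
  (exists D : set S, countable D /\ dense D).

(* T is Borel isomorphic to a Polish space. *)
Definition standard_borel (R : realType) (d : measure_display)
    (T : measurableType d) : Prop :=
  exists (S : metricType R) (f : T -> S),
    [/\ polish S, bijective f
      & forall A : set T,
          measurable A <-> exists2 B : set S, <<s open >> B & A = f @^-1` B].

Definition atomless (R : realType) (d : measure_display)
    (T : measurableType d) (nu : probability T R) : Prop :=
  forall A : set T, measurable A -> (0 < nu A)%E ->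
  exists B : set T, [/\ measurable B, B `<=` A & (0 < nu B < nu A)%E].

Record graphon (R : realType) (d : measure_display) (T : measurableType d) :=
  Graphon {
    graphon_fun :> T * T -> R ;
    graphon_measurable : measurable_fun [set: T * T] graphon_fun ;
    graphon_sym : forall x y, graphon_fun (x, y) = graphon_fun (y, x) ;
    graphon_itv : forall p, 0 <= graphon_fun p <= 1 }.

Section iid.
Context (R : realType) (d : measure_display) (T : measurableType d).
Variable nu : probability T R.

Definition cons_tuple n (p : T * n.-tuple T) : n.+1.-tuple T :=
  [tuple of p.1 :: p.2].

Lemma measurable_cons_tuple n : measurable_fun setT (@cons_tuple n).
Proof. exact: measurable_cons. Qed.

HB.instance Definition _ n :=
  isMeasurableFun.Build _ _ _ _ (@cons_tuple n) (@measurable_cons_tuple n).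

(* The n-fold product measure; cf. iid_rect. *)
Fixpoint iid n : probability (n.-tuple T) R :=
  match n with
  | 0 => \d_([tuple] : 0.-tuple T)
  | m.+1 => distribution (nu \x iid m)%E (@cons_tuple m)
  end.

Lemma measurable_rect n (A : 'I_n -> set T) : (forall i, measurable (A i)) ->
  measurable [set t : n.-tuple T | forall i, A i (tnth t i)].
Proof.
move=> mA.
have -> : [set t : n.-tuple T | forall i, A i (tnth t i)] =
    \big[setI/setT]_(i < n) ((fun t : n.-tuple T => tnth t i) @^-1` A i).
  rewrite -bigcap_seq; apply/seteqP; split => t /= h i; first by move=> _; exact: h.
  by apply: h; rewrite /= mem_index_enum.
apply: bigsetI_measurable => i _; rewrite -[X in measurable X]setTI.
exact: measurable_tnth.
Qed.

Lemma iid_rect n (A : 'I_n -> set T) : (forall i, measurable (A i)) ->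
  iid n [set t | forall i, A i (tnth t i)] = (\prod_(i < n) nu (A i))%E.
Proof.
elim: n A => [|n IH] A mA.
  by rewrite big_ord0 /= diracE mem_set// => -[].
rewrite big_ord_recl -IH => [|i]; last exact: mA.
pose B := [set t : n.-tuple T | forall i, A (lift ord0 i) (tnth t i)].
have mB : measurable B by apply: (@measurable_rect n (fun i => A (lift ord0 i))) => i; exact: mA.
rewrite -[RHS](product_measure1E nu (iid n) (mA ord0) mB).
rewrite /= /distribution /pushforward.
congr ((nu \x iid n)%E _); apply/seteqP; split => -[x t] /=.
  move=> h; split; first exact: (h ord0).
  by move=> i; have := h (lift ord0 i); rewrite tnthS.
move=> [hx ht] i; case: (unliftP ord0 i) => [j ->|-> //].
by rewrite tnthS; exact: ht.
Qed.

End iid.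

Section sgraph.
Variable n : nat.

Record sgraph := SGraph {
  adj : {ffun 'I_n * 'I_n -> bool} ;
  _ : [forall i, ~~ adj (i, i)] && [forall i, forall j, adj (i, j) == adj (j, i)]
}.

HB.instance Definition _ := [isSub for adj].
HB.instance Definition _ := [Finite of sgraph by <:].

Fact empty_sgraph_subproof (e := [ffun=> false] : {ffun 'I_n * 'I_n -> bool}) :
  [forall i, ~~ e (i, i)] && [forall i, forall j, e (i, j) == e (j, i)].
Proof.
by apply/andP; split; apply/forallP => i; [|apply/forallP => j]; rewrite !ffunE.
Qed.

HB.instance Definition _ := isPointed.Build sgraph (SGraph empty_sgraph_subproof).
HB.instance Definition _ := @isMeasurable.Build default_measure_display sgraph
  discrete_measurable discrete_measurable0 discrete_measurableC
  discrete_measurableU.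

Definition is_clique (g : sgraph) (A : {set 'I_n}) : bool :=
  [forall i in A, forall j in A, (i != j) ==> adj g (i, j)].

Definition clique_number (g : sgraph) : nat :=
  \max_(A : {set 'I_n} | is_clique g A) #|A|.

End sgraph.

Section random_graph.
Context (R : realType) (d : measure_display) (T : measurableType d).
Variables (nu : probability T R) (W : graphon R T) (n : nat).

(* Conditional probability, given that vertex i has type tnth x i for all i,
   that the independent edge trials produce exactly the graph g. *)
Definition edges_prob (x : n.-tuple T) (g : sgraph n) : R :=
  \prod_(p : 'I_n * 'I_n | (p.1 < p.2)%N)
    (if adj g p then W (tnth x p.1, tnth x p.2)
     else 1 - W (tnth x p.1, tnth x p.2)).

Definition random_graph_pmf (g : sgraph n) : \bar R :=
  (\int[iid nu n]_x (edges_prob x g)%:E)%E.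

(* The law of G(n, W), a probability measure on the finite set of simple
   graphs with vertex set 'I_n, all of whose subsets are measurable. *)
Definition random_graph (A : set (sgraph n)) : \bar R :=
  (\sum_(g : sgraph n) random_graph_pmf g * \d_g A)%E.

Lemma edges_prob_ge0 x g : 0 <= edges_prob x g.
Proof.
apply: prodr_ge0 => p _; have /andP[W0 W1] := graphon_itv W (tnth x p.1, tnth x p.2).
by case: ifP; rewrite ?subr_ge0.
Qed.

Lemma measurable_edges_prob g : measurable_fun setT (edges_prob ^~ g).
Proof.
rewrite (_ : edges_prob ^~ g = fun x => \prod_(p : 'I_n * 'I_n)
    (if (p.1 < p.2)%N then
       if adj g p then W (tnth x p.1, tnth x p.2)
       else 1 - W (tnth x p.1, tnth x p.2)
     else 1)); last by apply/funext => x; rewrite /edges_prob big_mkcond.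
apply: measurable_prod => p _; case: (p.1 < p.2)%N => //.
have mW : measurable_fun [set: n.-tuple T]
    (fun x => W (tnth x p.1, tnth x p.2)).
  apply: (measurableT_comp (graphon_measurable W)
    (g := fun x : n.-tuple T => (tnth x p.1, tnth x p.2))).
  apply: measurable_fun_pair; exact: measurable_tnth.
by case: (adj g p) => //; exact: measurable_funB.
Qed.

Lemma sum_edges_prob x : \sum_(g : sgraph n) edges_prob x g = 1.
Proof.
pose Q := {p : 'I_n * 'I_n | (p.1 < p.2)%N}.
pose F (q : Q) (b : bool) := let w := W (tnth x (val q).1, tnth x (val q).2) in
  if b then w else 1 - w.
have <- : \prod_(q : Q) \sum_(b : bool) F q b = 1.
  by rewrite big1// => q _; rewrite big_bool /F /= addrC subrK.
rewrite bigA_distr_bigA/=.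
pose e (f : {ffun Q -> bool}) (p : 'I_n * 'I_n) : bool := oapp f false (insub p).
pose s (f : {ffun Q -> bool}) := [ffun p : 'I_n * 'I_n => e f p || e f (p.2, p.1)].
have sP f : [forall i, ~~ s f (i, i)] &&
    [forall i, forall j, s f (i, j) == s f (j, i)].
  apply/andP; split; apply/forallP => i.
    by rewrite ffunE /e /= !insubF //= ltnn.
  by apply/forallP => j; rewrite !ffunE /= orbC.
pose h f : sgraph n := SGraph (sP f).
pose k (g : sgraph n) := [ffun q : Q => adj g (val q)].
have hE f (q : Q) : adj (h f) (val q) = f q.
  rewrite /h /= ffunE /e valK /= insubF ?orbF//=.
  by apply/negbTE; rewrite -leqNgt ltnW// (valP q).
have hk : cancel h k by move=> f; apply/ffunP => q; rewrite ffunE hE.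
have kh : cancel k h.
  move=> g; apply: val_inj; apply/ffunP => -[i j] /=; rewrite ffunE /e /=.
  have /andP[/forallP a0 /forallP aC] := valP g.
  have aS i' j' : adj g (i', j') = adj g (j', i').
    by apply/eqP; exact: (forallP (aC i')).
  have [lij|lji|/val_inj eij] := ltngtP i j.
  - by rewrite insubT /= insubF ?orbF /= ?ffunE//; apply/negbTE; rewrite -leqNgt ltnW.
  - by rewrite insubF /= ?insubT /= ?ffunE 1?aS//; apply/negbTE; rewrite -leqNgt ltnW.
  - by rewrite eij !insubF /= ?ltnn //; apply/esym/negbTE.
rewrite (reindex h) /=; last by exists k => ? _; [exact: hk|exact: kh].
apply: eq_bigr => f _; rewrite /edges_prob.
rewrite (reindex_omap (val : Q -> _) insub) /=; last first.
  by move=> p pP; rewrite insubT.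
apply: eq_big => [q|q _]; first by rewrite valK (valP q) eqxx.
by rewrite -/(h f) hE.
Qed.

Lemma random_graph_pmf_ge0 g : (0 <= random_graph_pmf g)%E.
Proof. by apply: integral_ge0 => x _; rewrite lee_fin edges_prob_ge0. Qed.

Lemma random_graph_pmf_fin_num g : random_graph_pmf g \is a fin_num.
Proof.
rewrite ge0_fin_numE ?random_graph_pmf_ge0// (@le_lt_trans _ _ 1%E) ?ltry//.
rewrite -(probability_setT (iid nu n)) -[leRHS]mul1e.
rewrite -(@integral_cst _ _ R (iid nu n) setT)//; apply: ge0_le_integral => //.
- by move=> x _; rewrite lee_fin edges_prob_ge0.
- by apply/measurable_EFinP; exact: measurable_edges_prob.
- move=> x _; rewrite lee_fin -(sum_edges_prob x) (bigD1 g)//= lerDl.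
  by apply: sumr_ge0 => k _; exact: edges_prob_ge0.
Qed.

Let random_graph0 : random_graph set0 = 0%E.
Proof. by rewrite /random_graph big1// => g _; rewrite measure0 mule0. Qed.

Let random_graph_ge0 A : (0 <= random_graph A)%E.
Proof.
apply: sume_ge0 => g _; apply: mule_ge0; [exact: random_graph_pmf_ge0|].
exact: measure_ge0.
Qed.

Let random_graph_sigma_additive : semi_sigma_additive random_graph.
Proof.
move=> F mF tF mUF.
rewrite [X in X @ _ --> _](_ : _ = (fun m => \sum_(g : sgraph n)
    (\sum_(0 <= i < m) random_graph_pmf g * \d_g (F i)))%E); last first.
  by apply/funext => m; rewrite exchange_big.
apply: cvg_nnesum => g _.
  apply: nearW => m; apply: sume_ge0 => i _.
  by apply: mule_ge0; [exact: random_graph_pmf_ge0|exact: measure_ge0].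
rewrite (_ : (fun m => _) = (fun m => random_graph_pmf g *
    \sum_(0 <= i < m) \d_g (F i))%E); last first.
  apply/funext => m; rewrite ge0_sume_distrr// => i _; exact: measure_ge0.
apply: cvgeZl; first exact: random_graph_pmf_fin_num.
exact: measure_semi_sigma_additive.
Qed.

HB.instance Definition _ := isMeasure.Build _ _ _ random_graph
  random_graph0 random_graph_ge0 random_graph_sigma_additive.

Let random_graph_setT : random_graph setT = 1%E.
Proof.
rewrite /random_graph; under eq_bigr do rewrite diracT mule1.
rewrite -ge0_integral_sum//; last 2 first.
- move=> g; apply/measurable_EFinP; exact: measurable_edges_prob.
- by move=> g x _; rewrite lee_fin edges_prob_ge0.
under eq_integral do rewrite sumEFin sum_edges_prob.
rewrite integral_cst// mul1e; exact: (probability_setT (iid nu n)).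
Qed.

HB.instance Definition _ := Measure_isProbability.Build _ _ _ random_graph
  random_graph_setT.

End random_graph.

Arguments random_graph {R d T} nu W n _.

(* Main.v *)
Require Import Defs.
From HB Require Import structures.
From mathcomp Require Import all_boot all_order all_algebra.
From mathcomp Require Import all_classical all_reals all_analysis.
From mathcomp Require Import measurable_realfun.
From mathcomp Require Import ring lra zify.

(** By Efron-Stein over the vertices, the variance of the clique number is at most its
    mean: deleting a vertex lowers the clique number by at most 1, and only if the vertex
    lies in a fixed maximum clique. If the mean is unbounded, Chebyshev's inequality
    concludes. If it is bounded, let K be the largest k such that G(m, W) contains a
    k-clique with positive probability for some m. Cutting the vertex set into independent
    blocks of size m shows that the clique number equals K with probability tending to 1,
    and again the variance is negligible against the squared mean. *)

Set Implicit Arguments.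
Unset Strict Implicit.
Unset Printing Implicit Defensive.
Import Order.TTheory GRing.Theory Num.Theory.
Import numFieldNormedType.Exports.
Local Open Scope classical_set_scope.
Local Open Scope ring_scope.

(** * Bounded measurable functions: closure and integrability *)

Definition bounded_measurable (R : realType) (d : measure_display)
    (X : measurableType d) (f : X -> R) :=
  measurable_fun setT f /\ exists M, forall x, `|f x| <= M.

Section bounded_measurable.
Context (R : realType) (d : measure_display) (X : measurableType d).
Implicit Types f g : X -> R.

Lemma bmeas_cst (c : R) : bounded_measurable (fun _ : X => c).
Proof. by split; [exact: measurable_cst|exists `|c|]. Qed.

Lemma bmeasD f g : bounded_measurable f -> bounded_measurable g ->
  bounded_measurable (fun x => f x + g x).
Proof.
move=> [mf [M fM]] [mg [N gN]]; split; first exact: measurable_funD.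
by exists (M + N) => x; rewrite (le_trans (ler_normD _ _))// lerD.
Qed.

Lemma bmeasM f g : bounded_measurable f -> bounded_measurable g ->
  bounded_measurable (fun x => f x * g x).
Proof.
move=> [mf [M fM]] [mg [N gN]]; split; first exact: measurable_funM.
by exists (M * N) => x; rewrite normrM ler_pM.
Qed.

Lemma bmeasB f g : bounded_measurable f -> bounded_measurable g ->
  bounded_measurable (fun x => f x - g x).
Proof.
move=> [mf [M fM]] [mg [N gN]]; split; first exact: measurable_funB.
by exists (M + N) => x; rewrite (le_trans (ler_normB _ _))// lerD.
Qed.

Lemma bmeasX f n : bounded_measurable f -> bounded_measurable (fun x => f x ^+ n).
Proof.
move=> bf; elim: n => [|n IH]; first exact: bmeas_cst.
rewrite (_ : (fun x => _) = (fun x => f x * f x ^+ n)); first exact: bmeasM.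
by apply/funext => x; rewrite exprS.
Qed.

Lemma bmeas_sum (I : Type) (r : seq I) (F : I -> X -> R) :
  (forall i, bounded_measurable (F i)) ->
  bounded_measurable (fun x => \sum_(i <- r) F i x).
Proof.
move=> bF; elim: r => [|i r IH].
  by under eq_fun do rewrite big_nil; exact: bmeas_cst.
by under eq_fun do rewrite big_cons; exact: bmeasD.
Qed.

Lemma bmeas_prod (I : Type) (r : seq I) (F : I -> X -> R) :
  (forall i, bounded_measurable (F i)) ->
  bounded_measurable (fun x => \prod_(i <- r) F i x).
Proof.
move=> bF; elim: r => [|i r IH].
  by under eq_fun do rewrite big_nil; exact: bmeas_cst.
by under eq_fun do rewrite big_cons; exact: bmeasM.
Qed.

Lemma bmeas_comp (d' : measure_display) (Y : measurableType d') (h : Y -> X) f :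
  measurable_fun setT h -> bounded_measurable f ->
  bounded_measurable (fun y => f (h y)).
Proof.
move=> mh [mf [M fM]]; split; first exact: (measurableT_comp mf mh).
by exists M => y; exact: fM.
Qed.

(** A constant dominates [f] and [P] is finite. Membership in this class settles the integrability
    conditions of the linearity lemmas below. *)
Lemma bmeas_integrable (P : probability X R) f :
  bounded_measurable f -> P.-integrable setT (EFin \o f).
Proof.
move=> [mf [M fM]]; apply: (@le_integrable _ _ R P setT _ _ (cst M%:E)) => //.
- exact/measurable_EFinP.
- move=> x _ /=; rewrite lee_fin (le_trans (fM x))// ler_norm//.
- exact: finite_measure_integrable_cst.
Qed.

Lemma bmeas_Rintegral_sum (P : probability X R) (I : Type) (r : seq I)
    (F : I -> X -> R) : (forall i, bounded_measurable (F i)) ->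
  \int[P]_x (\sum_(i <- r) F i x) = \sum_(i <- r) \int[P]_x F i x.
Proof.
move=> bF; elim: r => [|i r IH].
  rewrite big_nil -[RHS](mul0r (fine (P setT))) -Rintegral_cst//.
  by apply: eq_Rintegral => x _; rewrite big_nil.
rewrite big_cons -IH -RintegralD//; last 2 first.
- exact: bmeas_integrable.
- exact/bmeas_integrable/bmeas_sum.
by apply: eq_Rintegral => x _; rewrite big_cons.
Qed.

End bounded_measurable.

(** * Averages over a random point and a random element of a finite type *)

Section average.
Context (R : realType) (d : measure_display) (X : measurableType d).
Variables (P : probability X R) (G : finType) (p : X -> G -> R).
Hypotheses (p_ge0 : forall x g, 0 <= p x g)
  (p_sum1 : forall x, \sum_g p x g = 1)
  (p_bmeas : forall g, bounded_measurable (p ^~ g)).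

(** The expectation of [f x g] when [x] has law [P] and [g] has conditional law [p x]. It serves
    twice: for the whole random graph, with [edges_prob], and for one vertex and its neighbourhood,
    with [row_prob]. *)
Definition average (f : X -> G -> R) : R := \int[P]_x \sum_g p x g * f x g.

Definition bmeas_family (f : X -> G -> R) := forall g, bounded_measurable (f ^~ g).

Lemma bmeas_family_sum f : bmeas_family f ->
  bounded_measurable (fun x => \sum_g p x g * f x g).
Proof. by move=> gf; apply: bmeas_sum => g; exact: bmeasM. Qed.

Lemma average_cst c : average (fun _ _ => c) = c.
Proof.
rewrite /average; under eq_Rintegral do rewrite -mulr_suml p_sum1 mul1r.
by rewrite Rintegral_cst//= probability_setT mulr1.
Qed.

Lemma averageD f1 f2 : bmeas_family f1 -> bmeas_family f2 ->
  average (fun x g => f1 x g + f2 x g) = average f1 + average f2.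
Proof.
move=> g1 g2; rewrite /average -RintegralD//; last 2 first.
- exact/bmeas_integrable/bmeas_family_sum.
- exact/bmeas_integrable/bmeas_family_sum.
by apply: eq_Rintegral => x _; rewrite -big_split/=; under eq_bigr do rewrite mulrDr.
Qed.

Lemma averageZ c f : bmeas_family f ->
  average (fun x g => c * f x g) = c * average f.
Proof.
move=> gf; rewrite /average -RintegralZl//; last exact/bmeas_integrable/bmeas_family_sum.
by apply: eq_Rintegral => x _; rewrite mulr_sumr; under eq_bigr do rewrite mulrCA.
Qed.

Lemma averageB f1 f2 : bmeas_family f1 -> bmeas_family f2 ->
  average (fun x g => f1 x g - f2 x g) = average f1 - average f2.
Proof.
move=> g1 g2; under [in LHS]eq_fun do under eq_fun do rewrite -mulN1r.
rewrite averageD// ?averageZ ?mulN1r// => g; apply: bmeasM => //; exact: bmeas_cst.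
Qed.

Lemma average_sum (I : Type) (r : seq I) (F : I -> X -> G -> R) :
  (forall i, bmeas_family (F i)) ->
  average (fun x g => \sum_(i <- r) F i x g) = \sum_(i <- r) average (F i).
Proof.
move=> gF; elim: r => [|i r IH].
  rewrite big_nil -[RHS](average_cst 0); congr average.
  by apply/funext => x; apply/funext => g; rewrite big_nil.
rewrite big_cons -IH -averageD//; last by move=> g; apply: bmeas_sum => j; exact: gF.
by congr average; apply/funext => x; apply/funext => g; rewrite big_cons.
Qed.

Lemma average_ge0 f : (forall x g, 0 <= f x g) -> 0 <= average f.
Proof.
move=> f0; apply: Rintegral_ge0 => x _; apply: sumr_ge0 => g _.
by rewrite mulr_ge0 ?p_ge0 ?f0.
Qed.

Lemma le_average f1 f2 : bmeas_family f1 -> bmeas_family f2 ->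
  (forall x g, f1 x g <= f2 x g) -> average f1 <= average f2.
Proof.
move=> g1 g2 le12; rewrite -subr_ge0 -averageB//.
by apply: average_ge0 => x g; rewrite subr_ge0.
Qed.

(** The second moment about [c] splits into variance and squared bias. The two inequalities below
    follow by dropping the bias or by taking [c] to be the mean. *)
Lemma average_sqrB f c : bmeas_family f ->
  average (fun x g => (f x g - c) ^+ 2) =
  average (fun x g => f x g ^+ 2) - average f ^+ 2 + (average f - c) ^+ 2.
Proof.
move=> gf.
have gf2 : bmeas_family (fun x g => f x g ^+ 2) by move=> g; exact: bmeasX.
have gc : bmeas_family (fun x g => - (2 * c) * f x g).
  by move=> g; apply: bmeasM => //; exact: bmeas_cst.
have -> : (fun x g => (f x g - c) ^+ 2) =
    (fun x g => f x g ^+ 2 + (- (2 * c) * f x g + c ^+ 2)).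
  by apply/funext => x; apply/funext => g; ring.
have g1 : bmeas_family (fun _ _ => c ^+ 2) by move=> g; exact: bmeas_cst.
rewrite averageD//; last by move=> g; exact: bmeasD (gc g) (g1 g).
by rewrite averageD// averageZ// average_cst; ring.
Qed.

Lemma variance_le f c : bmeas_family f ->
  average (fun x g => f x g ^+ 2) - average f ^+ 2 <=
  average (fun x g => (f x g - c) ^+ 2).
Proof. by move=> gf; rewrite average_sqrB// lerDl sqr_ge0. Qed.

Lemma sqr_average_le f : bmeas_family f ->
  average f ^+ 2 <= average (fun x g => f x g ^+ 2).
Proof.
move=> gf; rewrite -subr_ge0.
have := @average_sqrB f (average f) gf; rewrite subrr expr0n addr0 => <-.
by apply: average_ge0 => x g; rewrite sqr_ge0.
Qed.

End average.

(** * Fubini's theorem for bounded functions *)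

Section fubini.
Context (R : realType) (d1 d2 : measure_display).
Context (X : measurableType d1) (Y : measurableType d2).
Variables (P : probability X R) (Q : probability Y R) (f : X * Y -> R).
Hypothesis bf : bounded_measurable f.

Let bfy y : bounded_measurable (fun x => f (x, y)).
Proof. by apply: bmeas_comp bf; exact: pair2_measurable. Qed.

Let Pf : (P \x Q)%E.-integrable setT (EFin \o f).
Proof.
have [mf [M fM]] := bf.
apply/integrable21ltyP; first exact/measurable_EFinP.
(* The iterated integral of the constant bound [M] is [M], as both measures have mass 1. *)
apply: (@le_lt_trans _ _ (\int[Q]_y \int[P]_x M%:E))%E.
  apply: ge0_le_integral => //.
  - by move=> y _; exact: integral_ge0.
  - apply: (@measurable_fun_fubini_tonelli_G _ _ _ _ _ P (abse \o (EFin \o f))).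
      by apply: measurableT_comp => //; exact/measurable_EFinP.
    by move=> z /=; rewrite lee_fin.
  - move=> y _; apply: ge0_le_integral => //.
    + apply: measurableT_comp => //; apply/measurable_EFinP; exact: (bfy y).1.
    + by move=> x _ /=; rewrite lee_fin.
by under eq_integral do rewrite integral_cst//= probability_setT mule1;
  rewrite integral_cst//= probability_setT mule1 ltry.
Qed.

Let GE y : (\int[P]_x (f (x, y))%:E = (\int[P]_x f (x, y))%:E)%E.
Proof. by rewrite /Rintegral fineK// integrable_fin_num//; exact: bmeas_integrable. Qed.

Lemma bmeas_Rintegral : bounded_measurable (fun y => \int[P]_x f (x, y)).
Proof.
have [_ [M fM]] := bf; split.
  apply/measurable_EFinP; rewrite (_ : _ \o _ = fubini_G P (EFin \o f)).
    exact: measurable_fubini_G Pf.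
  by apply/funext => y; rewrite /= -GE.
exists M => y; rewrite (le_trans (le_normr_Rintegral _ (bmeas_integrable P (bfy y))))//.
have bn : bounded_measurable (fun x => `|f (x, y)|).
  by split; [exact: measurableT_comp (bfy y).1|exists M => x; rewrite normr_id].
rewrite (le_trans (le_Rintegral measurableT (bmeas_integrable P bn)
  (bmeas_integrable P (bmeas_cst X M)) _))//.
by rewrite Rintegral_cst//= probability_setT mulr1.
Qed.

Lemma Rintegral_prod :
  \int[(P \x Q)%E]_z f z = \int[Q]_y \int[P]_x f (x, y).
Proof.
rewrite /Rintegral -integral21_prod_meas1//; congr fine.
by apply: eq_integral => y _; rewrite /fubini_G /= GE.
Qed.

End fubini.

(** * Induced subgraphs and addition of a vertex *)

Section graphs.

Lemma adj_irrefl n (g : sgraph n) i : adj g (i, i) = false.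
Proof. by have /andP[/forallP/(_ i)/negbTE] := valP g. Qed.

Lemma adj_sym n (g : sgraph n) i j : adj g (i, j) = adj g (j, i).
Proof. by have /andP[_ /forallP/(_ i)/forallP/(_ j)/eqP] := valP g. Qed.

Lemma sgraphP n (g h : sgraph n) : (forall i j, adj g (i, j) = adj h (i, j)) -> g = h.
Proof. by move=> gh; apply/val_inj/ffunP => -[i j]; exact: gh. Qed.

Fact graph_of_subproof n (e : rel 'I_n)
    (a := [ffun p : 'I_n * 'I_n => (p.1 != p.2) && (e p.1 p.2 || e p.2 p.1)]) :
  [forall i, ~~ a (i, i)] && [forall i, forall j, a (i, j) == a (j, i)].
Proof.
apply/andP; split; apply/forallP => i; first by rewrite ffunE eqxx.
by apply/forallP => j; rewrite !ffunE /= [j == i]eq_sym [e j i || _]orbC.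
Qed.

(** Symmetrizing and clearing the diagonal turns any relation into a simple graph, so a one-sided
    description suffices, as in [add_vertex]. *)
Definition graph_of n (e : rel 'I_n) : sgraph n := SGraph (graph_of_subproof e).

Lemma adj_graph_of n (e : rel 'I_n) i j :
  adj (graph_of e) (i, j) = (i != j) && (e i j || e j i).
Proof. by rewrite /= ffunE. Qed.

Definition induced m n (s : 'I_m -> 'I_n) (g : sgraph n) : sgraph m :=
  graph_of (fun i j => adj g (s i, s j)).

Lemma adj_induced m n (s : 'I_m -> 'I_n) (g : sgraph n) i j :
  adj (induced s g) (i, j) = adj g (s i, s j).
Proof.
rewrite adj_graph_of [adj g (s j, _)]adj_sym orbb.
by have [->|//] := eqVneq i j; rewrite adj_irrefl.
Qed.

(** The new vertex is [ord0], with neighbourhood [b], in line with [cons_tuple], which puts the new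
    type first. *)
Definition add_vertex n (b : {ffun 'I_n -> bool}) (g : sgraph n) : sgraph n.+1 :=
  graph_of (fun i j => match unlift ord0 i, unlift ord0 j with
                       | None, Some j' => b j'
                       | Some i', Some j' => adj g (i', j')
                       | _, _ => false
                       end).

Lemma adj_add_vertex0 n b (g : sgraph n) j :
  adj (add_vertex b g) (ord0, lift ord0 j) = b j.
Proof. by rewrite adj_graph_of neq_lift unlift_none liftK orbF. Qed.

Lemma adj_add_vertexS n b (g : sgraph n) i j :
  adj (add_vertex b g) (lift ord0 i, lift ord0 j) = adj g (i, j).
Proof.
rewrite adj_graph_of !liftK [adj g (j, i)]adj_sym orbb (inj_eq (@lift_inj _ _)).
by have [->|//] := eqVneq i j; rewrite adj_irrefl.
Qed.

Lemma sum_add_vertex (V : nmodType) n (F : sgraph n.+1 -> V) :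
  \sum_g F g = \sum_(g : sgraph n) \sum_(b : {ffun 'I_n -> bool}) F (add_vertex b g).
Proof.
rewrite pair_bigA/= (reindex (fun p : sgraph n * {ffun 'I_n -> bool} =>
  add_vertex p.2 p.1))//=.
exists (fun g => (induced (lift ord0) g, [ffun j => adj g (ord0, lift ord0 j)])).
  move=> [g b] _ /=; congr pair.
    by apply: sgraphP => i j; rewrite adj_induced adj_add_vertexS.
  by apply/ffunP => j; rewrite ffunE adj_add_vertex0.
move=> g _; apply: sgraphP => i j.
case: (unliftP ord0 i) => [i'|] ->; case: (unliftP ord0 j) => [j'|] ->.
- by rewrite adj_add_vertexS adj_induced.
- by rewrite adj_sym adj_add_vertex0 ffunE adj_sym.
- by rewrite adj_add_vertex0 ffunE.
- by rewrite !adj_irrefl.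
Qed.

Lemma eq_sgraph0 (g h : sgraph 0) : g = h.
Proof. by apply: sgraphP => -[]. Qed.

End graphs.

(** Marginals of independent bits: each coordinate outside the image of [s] sums out to the factor
    [rho i true + rho i false = 1]. *)
Lemma sum_prod_marginal (R : comPzRingType) (I J : finType) (s : J -> I)
    (rho : I -> bool -> R) (H : {ffun J -> bool} -> R) :
  injective s -> (forall i, rho i true + rho i false = 1) ->
  \sum_(b : {ffun I -> bool}) (\prod_i rho i (b i)) * H [ffun j => b (s j)] =
  \sum_(c : {ffun J -> bool}) (\prod_j rho (s j) (c j)) * H c.
Proof.
move=> s_inj rho1.
rewrite (partition_big (fun b : {ffun I -> bool} => [ffun j => b (s j)]) predT)//=.
apply: eq_bigr => c _.
rewrite (eq_bigr (fun b : {ffun I -> bool} => (\prod_i rho i (b i)) * H c)); last first.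
  by move=> b /eqP ->.
rewrite -mulr_suml; congr (_ * _).
(* [F i] holds the values at [i] compatible with [c], so the fibre over [c] is a product set and the
   sum over it factors. *)
pose F i : pred bool := fun v => [forall j, (s j == i) ==> (c j == v)].
have -> : \sum_(b : {ffun I -> bool} | [ffun j => b (s j)] == c) \prod_i rho i (b i) =
    \sum_(b in family F) \prod_i rho i (b i).
  apply: eq_bigl => b; apply/eqP/familyP => [bc i|bF].
    by apply/forallP => j; rewrite -bc ffunE; apply/implyP => /eqP ->.
  apply/ffunP => j; rewrite ffunE; have /forallP/(_ j) := bF (s j).
  by rewrite eqxx /= => /eqP.
rewrite -bigA_distr_big_dep/=.
(* By injectivity [i] has at most one preimage [j], which forces the value [c j]; without a preimage
   both values are allowed and sum to 1. *)
have FE i : \sum_(v | F i v) rho i v =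
    \prod_(j | s j == i) rho i (c j).
  case: (pickP (fun j => s j == i)) => [j /eqP sji|no].
    have oneJ k : (s k == i) = (k == j) by rewrite -sji (inj_eq s_inj).
    rewrite (eq_bigl (pred1 (c j))) ?big_pred1_eq; last first.
      move=> v /=; apply/forallP/eqP => [/(_ j)|-> k]; first by rewrite sji eqxx => /eqP.
      by rewrite oneJ; apply/implyP => /eqP ->.
    by rewrite (eq_bigl (pred1 j)) ?big_pred1_eq// => k; rewrite oneJ.
  rewrite [RHS]big_pred0// (eq_bigl predT); last first.
    by move=> v; apply/forallP => j; rewrite no.
  by rewrite big_bool; exact: rho1.
under eq_bigr do rewrite FE.
rewrite [RHS](partition_big s predT)//=; apply: eq_bigr => i _.
by apply: eq_bigr => j /eqP ->.
Qed.

(** * Revealing the random graph one vertex at a time *)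

Section model.
Context (R : realType) (d : measure_display) (T : measurableType d).
Variables (nu : probability T R) (W : graphon R T).

Definition edge_prob (y z : T) (b : bool) : R := if b then W (y, z) else 1 - W (y, z).

Lemma edge_prob_ge0 y z b : 0 <= edge_prob y z b.
Proof.
by have /andP[W0 W1] := graphon_itv W (y, z); case: b; rewrite /edge_prob ?subr_ge0.
Qed.

Lemma edge_prob_sum1 y z : edge_prob y z true + edge_prob y z false = 1.
Proof. by rewrite /edge_prob addrC subrK. Qed.

Lemma bmeas_edge_prob b : bounded_measurable (fun p : T * T => edge_prob p.1 p.2 b).
Proof.
have bW : bounded_measurable (fun p : T * T => W (p.1, p.2)).
  rewrite (_ : (fun p => _) = W); last by apply/funext => -[].
  split; first exact: graphon_measurable.
  by exists 1 => p; have /andP[W0 W1] := graphon_itv W p; rewrite ger0_norm.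
by case: b => //; apply: bmeasB => //; exact: bmeas_cst.
Qed.

(** The conditional probability, given the types, that a new vertex of type [y] has neighbourhood
    [b] among vertices of types [t]. *)
Definition row_prob n (y : T) (t : n.-tuple T) (b : {ffun 'I_n -> bool}) : R :=
  \prod_(j < n) edge_prob y (tnth t j) (b j).

Lemma row_prob_ge0 n y (t : n.-tuple T) b : 0 <= row_prob y t b.
Proof. by apply: prodr_ge0 => j _; exact: edge_prob_ge0. Qed.

Lemma row_prob_sum1 n y (t : n.-tuple T) : \sum_b row_prob y t b = 1.
Proof.
rewrite -(bigA_distr_bigA (fun j b => edge_prob y (tnth t j) b)) big1// => j _.
by rewrite big_bool; exact: edge_prob_sum1.
Qed.

Lemma bmeas_row_prob2 n (b : {ffun 'I_n -> bool}) :
  bounded_measurable (fun p : T * n.-tuple T => row_prob p.1 p.2 b).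
Proof.
apply: bmeas_prod => j.
apply: (bmeas_comp (h := fun p : T * n.-tuple T => (p.1, tnth p.2 j)))
  (bmeas_edge_prob (b j)).
apply: measurable_fun_pair => //=.
by apply: (@measurableT_comp _ _ _ _ _ _ (fun t : n.-tuple T => tnth t j)) => //;
  exact: measurable_tnth.
Qed.

Lemma bmeas_row_prob n (t : n.-tuple T) b : bounded_measurable (fun y => row_prob y t b).
Proof.
apply: (bmeas_comp (h := fun y => (y, t)) _ (bmeas_row_prob2 b)).
exact: pair2_measurable.
Qed.

Lemma bmeas_edges_prob n g : bounded_measurable (fun x : n.-tuple T => edges_prob W x g).
Proof.
split; first exact: measurable_edges_prob.
exists 1 => x; rewrite ger0_norm ?edges_prob_ge0// -(sum_edges_prob W x).
by rewrite (bigD1 g)//= lerDl sumr_ge0// => k _; exact: edges_prob_ge0.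
Qed.

Lemma edges_probE n (x : n.-tuple T) g : edges_prob W x g =
  \prod_(i < n) \prod_(j < n | (i < j)%N) edge_prob (tnth x i) (tnth x j) (adj g (i, j)).
Proof. by rewrite pair_big_dep/=; apply: eq_bigr => -[i j] _. Qed.

(** The pairs [i < j] with [i = ord0] form the row of the new vertex; the others are the pairs of
    the old graph, shifted by one. *)
Lemma edges_prob_add_vertex n y (t : n.-tuple T) b g :
  edges_prob W (Defs.cons_tuple (y, t)) (add_vertex b g) =
  row_prob y t b * edges_prob W t g.
Proof.
rewrite !edges_probE big_ord_recl; congr (_ * _).
  rewrite big_mkcond big_ord_recl/= mul1r; apply: eq_bigr => j _.
  by rewrite adj_add_vertex0 tnthS.
apply: eq_bigr => i _.
rewrite big_mkcond big_ord_recl/= mul1r [RHS]big_mkcond; apply: eq_bigr => j _.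
by rewrite adj_add_vertexS !tnthS.
Qed.

Definition expect n (f : n.-tuple T -> sgraph n -> R) : R :=
  average (iid nu n) (fun x g => edges_prob W x g) f.

(* Expectation given the last n vertices and the graph they induce; vertex 0 is
   integrated out. *)
Definition cond_expect n (f : n.+1.-tuple T -> sgraph n.+1 -> R)
    (t : n.-tuple T) (g : sgraph n) : R :=
  average nu (fun y b => row_prob y t b)
    (fun y b => f (Defs.cons_tuple (y, t)) (add_vertex b g)).

Lemma bmeas_family_cond_expect n (f : n.+1.-tuple T -> sgraph n.+1 -> R) :
  bmeas_family f -> bmeas_family (cond_expect f).
Proof.
move=> gf g; apply: (bmeas_Rintegral nu (iid nu n) (f := fun p : T * n.-tuple T =>
  \sum_b row_prob p.1 p.2 b * f (Defs.cons_tuple (p.1, p.2)) (add_vertex b g))).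
apply: bmeas_sum => b; apply: bmeasM; first exact: bmeas_row_prob2.
rewrite (_ : (fun p => _) = fun p => f (Defs.cons_tuple p) (add_vertex b g)).
  by apply: bmeas_comp (gf _); exact: measurable_cons_tuple.
by apply/funext => -[].
Qed.

Lemma bmeas_family_slice n (f : n.+1.-tuple T -> sgraph n.+1 -> R) t g : bmeas_family f ->
  bmeas_family (fun y (b : {ffun 'I_n -> bool}) =>
    f (Defs.cons_tuple (y, t)) (add_vertex b g)).
Proof.
move=> gf b; apply: bmeas_comp (gf _).
by apply: measurableT_comp; [exact: measurable_cons_tuple|exact: pair2_measurable].
Qed.

(** The tower property. By definition [iid] adds a type through [nu \x iid nu n]; Fubini integrates
    vertex 0 first, and the edge probability splits off its row. *)
Lemma expect_recl n (f : n.+1.-tuple T -> sgraph n.+1 -> R) : bmeas_family f ->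
  expect f = expect (cond_expect f).
Proof.
move=> gf; pose F x := \sum_g edges_prob W x g * f x g.
have bF : bounded_measurable F.
  by apply: bmeas_sum => g; apply: bmeasM; [exact: bmeas_edges_prob|exact: gf].
have bFc : bounded_measurable (F \o @Defs.cons_tuple d T n).
  by apply: bmeas_comp bF; exact: measurable_cons_tuple.
transitivity (\int[(nu \x iid nu n)%E]_z (F \o @Defs.cons_tuple d T n) z).
  rewrite /expect /average /Rintegral/=; congr fine.
  rewrite integral_distribution//; last exact: (bmeas_integrable (nu \x iid nu n)%E bFc).
  by apply/measurable_EFinP; exact: bF.1.
rewrite Rintegral_prod//; apply: eq_Rintegral => t _.
under eq_bigr => g _.
  rewrite /cond_expect /average -RintegralZl//; last first.
    apply: bmeas_integrable; apply: bmeas_family_sum (bmeas_family_slice _ _ gf).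
    exact: bmeas_row_prob.
  over.
rewrite -bmeas_Rintegral_sum; last first.
  move=> g; apply: bmeasM; first exact: bmeas_cst.
  by apply: bmeas_family_sum (bmeas_family_slice _ _ gf); exact: bmeas_row_prob.
apply: eq_Rintegral => y _; rewrite /F /= sum_add_vertex; apply: eq_bigr => g _.
rewrite mulr_sumr; apply: eq_bigr => b _.
by rewrite edges_prob_add_vertex; ring.
Qed.

End model.

(** * Statistics of induced subgraphs, independence and the Efron-Stein inequality *)

Section pullback.
Context (R : realType) (d : measure_display) (T : measurableType d).
Variables (nu : probability T R) (W : graphon R T).

Let ep_ge0 n x g := @edges_prob_ge0 R d T W n x g.
Let ep_sum1 n x := @sum_edges_prob R d T W n x.
Let ep_bm n g := @bmeas_edges_prob R d T W n g.
Let rp_sum1 n (t : n.-tuple T) y := @row_prob_sum1 R d T W n y t.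
Let rp_bm n (t : n.-tuple T) b := @bmeas_row_prob R d T W n t b.

(** Makes a statistic of G(m, W) one of G(n, W) that sees only the vertices in the image of [s]:
    [lift i] deletes vertex [i], while [lshift] and [rshift] select disjoint blocks. *)
Definition pullback m n (s : 'I_m -> 'I_n) (f : m.-tuple T -> sgraph m -> R)
    (x : n.-tuple T) (g : sgraph n) : R :=
  f [tuple tnth x (s i) | i < m] (induced s g).

Lemma bmeas_family_pull m n (s : 'I_m -> 'I_n) f :
  bmeas_family f -> bmeas_family (pullback s f).
Proof.
move=> gf g; apply: bmeas_comp (gf _).
apply/measurable_fun_tnthP => i; rewrite (_ : _ \o _ = fun x => tnth x (s i)).
  exact: measurable_tnth.
by apply/funext => x; rewrite /= tnth_mktuple.
Qed.

Lemma pull_lift0 n (f : n.-tuple T -> sgraph n -> R) y t b g :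
  pullback (lift ord0) f (Defs.cons_tuple (y, t)) (add_vertex b g) = f t g.
Proof.
rewrite /pullback; congr (f _ _).
  by apply: eq_from_tnth => i; rewrite tnth_mktuple tnthS.
by apply: sgraphP => i j; rewrite adj_induced adj_add_vertexS.
Qed.

(** The factor from [h] does not see vertex 0 and comes out. The factor from [f] sees only the image
    of [s1], so the edges from vertex 0 to other vertices are summed out. *)
Lemma cond_expect_pull_mul m n (s : 'I_m -> 'I_n) (s1 : 'I_m.+1 -> 'I_n.+1)
    (f : m.+1.-tuple T -> sgraph m.+1 -> R) (h : n.-tuple T -> sgraph n -> R) t g :
  injective s -> s1 ord0 = ord0 -> (forall i, s1 (lift ord0 i) = lift ord0 (s i)) ->
  bmeas_family f ->
  cond_expect nu W (fun x g => pullback (lift ord0) h x g * pullback s1 f x g) t g =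
  h t g * pullback s (cond_expect nu W f) t g.
Proof.
move=> s_inj s10 s1S gf.
have gpf := bmeas_family_slice t g (bmeas_family_pull s1 gf).
transitivity (h t g * cond_expect nu W (pullback s1 f) t g).
  rewrite /cond_expect -averageZ//. congr average.
  by apply/funext => y; apply/funext => b; rewrite pull_lift0.
congr (_ * _); rewrite /cond_expect /pullback /average; apply: eq_Rintegral => y _.
rewrite /row_prob; under [RHS]eq_bigr do under eq_bigr do rewrite tnth_mktuple.
rewrite -(sum_prod_marginal (rho := fun i v => edge_prob W y (tnth t i) v)
  (fun c => f (Defs.cons_tuple (y, [tuple tnth t (s i) | i < m]))
              (add_vertex c (induced s g))) s_inj); last first.
  by move=> i; exact: edge_prob_sum1.
apply: eq_bigr => b _; congr (_ * f _ _).
  apply: eq_from_tnth => i; rewrite tnth_mktuple.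
  case: (unliftP ord0 i) => [i'|] ->; last by rewrite s10.
  by rewrite s1S !tnthS tnth_mktuple.
apply: sgraphP => i j; rewrite adj_induced.
case: (unliftP ord0 i) => [i'|] ->; case: (unliftP ord0 j) => [j'|] ->.
- by rewrite !s1S !adj_add_vertexS adj_induced.
- rewrite s1S s10 [LHS]adj_sym [in RHS]adj_sym. by rewrite !adj_add_vertex0 ffunE.
- by rewrite s1S s10 !adj_add_vertex0 ffunE.
- by rewrite s10 !adj_irrefl.
Qed.

Lemma cond_expect_pull m n (s : 'I_m -> 'I_n) (s1 : 'I_m.+1 -> 'I_n.+1)
    (f : m.+1.-tuple T -> sgraph m.+1 -> R) t g :
  injective s -> s1 ord0 = ord0 -> (forall i, s1 (lift ord0 i) = lift ord0 (s i)) ->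
  bmeas_family f ->
  cond_expect nu W (pullback s1 f) t g = pullback s (cond_expect nu W f) t g.
Proof.
move=> s_inj s10 s1S gf.
rewrite -[RHS]mul1r -(cond_expect_pull_mul (fun _ _ => 1) t g s_inj s10 s1S gf).
by congr cond_expect; apply/funext => x; apply/funext => g'; rewrite /pullback mul1r.
Qed.

Lemma expect0 (f : 0.-tuple T -> sgraph 0 -> R) x g : expect nu W f = f x g.
Proof.
rewrite -[RHS](average_cst (iid nu 0) (@ep_sum1 0)); congr average.
apply/funext => x'; apply/funext => g'.
by rewrite (tuple0 x') (tuple0 x) (eq_sgraph0 g' g).
Qed.

(* Vertex-disjoint induced subgraphs of G(m + n, W) are independent and
   distributed as G(m, W) and G(n, W). *)
Lemma expect_pull_mul m n (f : m.-tuple T -> sgraph m -> R)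
    (h : n.-tuple T -> sgraph n -> R) : bmeas_family f -> bmeas_family h ->
  expect nu W (fun x g => pullback (@rshift m n) h x g * pullback (@lshift m n) f x g) =
  expect nu W h * expect nu W f.
Proof.
elim: m f => [|m IH] f gf gh.
  have [g0] : inhabited (sgraph 0) by exists; exact: point.
  rewrite (expect0 f [tuple] g0) mulrC -(averageZ (iid nu n) (@ep_bm n) _ gh).
  congr average.
  apply/funext => x; apply/funext => g; rewrite mulrC; congr (_ * _).
    by rewrite /pullback (tuple0 [tuple _ | _ < _]) (eq_sgraph0 (induced _ _) g0).
  rewrite /pullback; congr (h _ _).
    by apply: eq_from_tnth => i; rewrite tnth_mktuple; congr (tnth x _); exact: val_inj.
  by apply: sgraphP => i j; rewrite adj_induced; congr (adj g (_, _)); apply: val_inj.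
rewrite (expect_recl nu W gf) -IH//; last exact: bmeas_family_cond_expect.
have gfh : bmeas_family (fun x g =>
    pullback (@rshift m.+1 n) h x g * pullback (@lshift m.+1 n) f x g).
  by move=> g; apply: bmeasM; exact: bmeas_family_pull.
rewrite (expect_recl nu W gfh); congr average; apply/funext => t; apply/funext => g.
(* Vertex 0 lies in the block of [f], so the factor from [h] passes through the conditioning
   unchanged. *)
rewrite -(@cond_expect_pull_mul _ _ (@lshift m n) (@lshift m.+1 n)) //; first last.
- by move=> i; apply: val_inj.
- by apply: val_inj.
- exact: lshift_inj.
congr cond_expect; apply/funext => x; apply/funext => g'; congr (_ * _).
rewrite /pullback; congr (h _ _).
  apply: eq_from_tnth => i; rewrite !tnth_mktuple; congr (tnth x _); exact: val_inj.
by apply: sgraphP => i j; rewrite !adj_induced; congr (adj g' (_, _)); apply: val_inj.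
Qed.

(* Efron--Stein: integrating out the first vertex splits the variance into the
   conditional variance, bounded through [F ord0], and the variance of the
   conditional expectation, bounded inductively through Jensen. *)
Lemma efron_stein n (f : n.-tuple T -> sgraph n -> R)
    (F : 'I_n -> n.-1.-tuple T -> sgraph n.-1 -> R) :
  bmeas_family f -> (forall i, bmeas_family (F i)) ->
  expect nu W (fun x g => f x g ^+ 2) - expect nu W f ^+ 2 <=
  \sum_i expect nu W (fun x g => (f x g - pullback (lift i) (F i) x g) ^+ 2).
Proof.
elim: n f F => [|n IH] f F gf gF.
  have g0 : sgraph 0 by exact: point.
  by rewrite big_ord0 !(expect0 _ [tuple] g0) subrr.
have gX k (h : k.-tuple T -> sgraph k -> R) :
    bmeas_family h -> bmeas_family (fun x g => h x g ^+ 2).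
  by move=> gh g; exact: bmeasX.
have gfF i : bmeas_family (fun x g => f x g - pullback (lift i) (F i) x g).
  by move=> g; apply: bmeasB; [exact: gf|exact: bmeas_family_pull].
have gK := bmeas_family_cond_expect nu W gf.
have gKX : bmeas_family (cond_expect nu W (fun x g => f x g ^+ 2)).
  by apply: bmeas_family_cond_expect; exact: gX.
(* Integrating vertex 0 out of the approximations of [f] gives the approximations of [cond_expect f]
   for the induction. *)
have [F' gF' KF] : exists2 F' : 'I_n -> n.-1.-tuple T -> sgraph n.-1 -> R,
    forall i, bmeas_family (F' i) & forall i t g,
    cond_expect nu W (pullback (lift (lift ord0 i)) (F (lift ord0 i))) t g =
    pullback (lift i) (F' i) t g.
  case: n {IH f gf gfF gK gKX} F gF => [|n] F gF.
    (* A dummy value: ['I_0] has no index to serve. *)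
    exists (fun _ _ _ => 0) => [[]//|[]//].
  exists (fun i => cond_expect nu W (F (lift ord0 i))) => [i|i t g].
    exact: bmeas_family_cond_expect.
  apply: cond_expect_pull => //; first exact: lift_inj.
  - exact: val_inj.
  - by move=> j; apply: val_inj; rewrite /= /bump /=; lia.
rewrite expect_recl; last exact: gX.
rewrite (expect_recl nu W gf) big_ord_recl.
rewrite -(subrK (expect nu W (fun t g => cond_expect nu W f t g ^+ 2)) (expect _ _ _)).
rewrite -addrA lerD//.
  rewrite -averageB//; last 2 first.
  - exact: ep_bm.
  - exact: gX.
  rewrite expect_recl; last exact: gX.
  apply: le_average => //; first exact: ep_bm.
  - by move=> g; apply: bmeasB; [exact: gKX|exact: (gX _ _ gK)].
  - by apply: bmeas_family_cond_expect; exact: gX.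
  move=> t g; have gs := bmeas_family_slice t g gf.
  apply: le_trans (variance_le nu (rp_sum1 t) (rp_bm t) (F ord0 t g) gs) _.
  rewrite le_eqVlt; apply/orP; left; apply/eqP; congr average.
  by apply/funext => y; apply/funext => b; rewrite pull_lift0.
apply: le_trans (IH _ F' gK gF') _; apply: ler_sum => i _.
rewrite [leRHS]expect_recl; last exact: gX.
apply: le_average => //; first exact: ep_bm.
- move=> g; apply: bmeasX; apply: bmeasB; [exact: gK|exact: bmeas_family_pull].
- by apply: bmeas_family_cond_expect; exact: gX.
move=> t g; rewrite -KF -averageB//; last 2 first.
- exact: bmeas_family_slice.
- by apply: (bmeas_family_slice t g); exact: bmeas_family_pull.
apply: sqr_average_le => //; first by move=> y b; exact: row_prob_ge0.
by apply: (bmeas_family_slice t g (gfF (lift ord0 i))).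
Qed.

End pullback.

(** * Cliques and vertex deletion *)

Section clique.

Lemma is_cliqueP n (g : sgraph n) (A : {set 'I_n}) :
  reflect (forall i j, i \in A -> j \in A -> i != j -> adj g (i, j)) (is_clique g A).
Proof.
apply: (iffP forall_inP) => [cA i j iA jA ij|cA i iA].
  by have /forall_inP/(_ _ jA) := cA _ iA; rewrite ij.
by apply/forall_inP => j jA; apply/implyP; exact: cA.
Qed.

Lemma clique_number_ge n (g : sgraph n) A : is_clique g A -> (#|A| <= clique_number g)%N.
Proof. by move=> cA; exact: (leq_bigmax_cond (F := fun A : {set 'I_n} => #|A|)). Qed.

Lemma clique_numberP n (g : sgraph n) :
  exists2 A, is_clique g A & clique_number g = #|A|.
Proof.
have c0 : (0 < #|[pred A : {set 'I_n} | is_clique g A]|)%N.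
  apply/card_gt0P; exists (finset.set0 : {set 'I_n}); rewrite inE; apply/is_cliqueP => i j.
  by rewrite finset.in_set0.
have [A cA wA] := eq_bigmax_cond (fun A : {set 'I_n} => #|A|) c0.
by exists A.
Qed.

Lemma clique_number_le_order n (g : sgraph n) : (clique_number g <= n)%N.
Proof. by have [A _ ->] := clique_numberP g; rewrite -[leqRHS]card_ord max_card. Qed.

Lemma clique_number_gt0 n (g : sgraph n.+1) : (0 < clique_number g)%N.
Proof.
rewrite -(cards1 (@ord0 n)); apply: clique_number_ge; apply/is_cliqueP => i j.
by rewrite !finset.in_set1 => /eqP -> /eqP ->; rewrite eqxx.
Qed.

Lemma clique_number_induced_le m n (s : 'I_m -> 'I_n) (g : sgraph n) :
  injective s -> (clique_number (induced s g) <= clique_number g)%N.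
Proof.
move=> s_inj; have [A /is_cliqueP cA ->] := clique_numberP (induced s g).
rewrite -(card_imset _ s_inj); apply: clique_number_ge; apply/is_cliqueP.
move=> _ _ /imsetP[i iA ->] /imsetP[j jA ->]; rewrite (inj_eq s_inj) => ij.
by rewrite -adj_induced; exact: cA.
Qed.

(** Pulling [A] back along [s] loses no vertex, as [A] lies in the image. *)
Lemma le_clique_number_induced m n (s : 'I_m -> 'I_n) (g : sgraph n) A :
  injective s -> is_clique g A -> (forall a, a \in A -> exists i, a = s i) ->
  (#|A| <= clique_number (induced s g))%N.
Proof.
move=> s_inj /is_cliqueP cA As.
apply: (@leq_trans #|s @^-1: A|).
  apply: leq_trans (leq_imset_card s _); apply: subset_leq_card.
  apply/fintype.subsetP => a aA; have [i ai] := As _ aA; rewrite ai.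
  by apply: imset_f; rewrite finset.inE -ai.
apply: clique_number_ge; apply/is_cliqueP => i j; rewrite !finset.inE => iA jA ij.
by rewrite adj_induced; apply: cA; rewrite ?(inj_eq s_inj).
Qed.

(** Fix a maximum clique [A]. Deleting a vertex outside [A] keeps [A]; deleting one inside leaves a
    clique with one vertex less. So the [i]-th square is at most the indicator of [i \in A]. *)
Lemma sum_sqr_clique_number_lift (R : realType) n (g : sgraph n) :
  \sum_(i < n) ((clique_number g)%:R - (clique_number (induced (lift i) g))%:R) ^+ 2
    <= (clique_number g)%:R :> R.
Proof.
have [A cA wA] := clique_numberP g.
have lift_range (B : {set 'I_n}) i : i \notin B ->
    forall a, a \in B -> exists j, a = lift i j.
  move=> iB a aB; case: (unliftP i a) => [j ->|ai]; first by exists j.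
  by rewrite -ai aB in iB.
have bound i : (clique_number g <= clique_number (induced (lift i) g) + (i \in A))%N.
  have [iA|iA] := boolP (i \in A); last first.
    by rewrite addn0 wA le_clique_number_induced//; [exact: lift_inj|exact: lift_range].
  rewrite wA (cardsD1 i) iA addnC leq_add2r le_clique_number_induced//.
  - exact: lift_inj.
  - apply/is_cliqueP => j k; rewrite !finset.in_setD1 => /andP[_ jA] /andP[_ kA].
    by move: cA => /is_cliqueP; exact.
  - by apply: lift_range; rewrite finset.in_setD1 eqxx.
apply: (@le_trans _ _ (\sum_(i < n) (i \in A)%:R)).
  apply: ler_sum => i _.
  have := bound i; have := clique_number_induced_le g (@lift_inj _ i).
  rewrite -(ler_nat R) -[in X in _ -> X -> _](ler_nat R) natrD.
  by case: (i \in A) => /= h1 h2; nra.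
by rewrite -natr_sum -big_mkcond/= sum1_card wA.
Qed.

End clique.

(** * Expectations of graph statistics *)

Section graph_expectation.
Context (R : realType) (d : measure_display) (T : measurableType d).
Variables (nu : probability T R) (W : graphon R T).

(** Kept as an average over types and graphs, so that independence and Efron-Stein apply;
    [graph_expectE] returns to the law of the graph alone. *)
Definition graph_expect n (f : sgraph n -> R) : R := expect nu W (fun _ g => f g).

Let ep_ge0 n x g := @edges_prob_ge0 R d T W n x g.
Let ep_sum1 n x := @sum_edges_prob R d T W n x.
Let ep_bm n g := @bmeas_edges_prob R d T W n g.

Lemma bmeas_family_graph n (f : sgraph n -> R) :
  bmeas_family (fun (_ : n.-tuple T) g => f g).
Proof. by move=> g; exact: bmeas_cst. Qed.
Hint Resolve bmeas_family_graph : core.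

Lemma graph_expect_cst n (c : R) : graph_expect (fun _ : sgraph n => c) = c.
Proof. exact (average_cst (iid nu n) (@ep_sum1 n) c). Qed.

Lemma graph_expectD n (f1 f2 : sgraph n -> R) :
  graph_expect (fun g => f1 g + f2 g) = graph_expect f1 + graph_expect f2.
Proof. exact (averageD (iid nu n) (@ep_bm n)
  (bmeas_family_graph f1) (bmeas_family_graph f2)). Qed.

Lemma graph_expectB n (f1 f2 : sgraph n -> R) :
  graph_expect (fun g => f1 g - f2 g) = graph_expect f1 - graph_expect f2.
Proof. exact (averageB (iid nu n) (@ep_bm n)
  (bmeas_family_graph f1) (bmeas_family_graph f2)). Qed.

Lemma graph_expectZ n c (f : sgraph n -> R) :
  graph_expect (fun g => c * f g) = c * graph_expect f.
Proof. exact (averageZ (iid nu n) (@ep_bm n) c (bmeas_family_graph f)). Qed.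

Lemma le_graph_expect n (f1 f2 : sgraph n -> R) :
  (forall g, f1 g <= f2 g) -> graph_expect f1 <= graph_expect f2.
Proof.
move=> le12; apply: (le_average (iid nu n) (@ep_ge0 n) (@ep_bm n)) => //;
  exact: bmeas_family_graph.
Qed.

Lemma graph_expect_sqrB n (f : sgraph n -> R) :
  graph_expect (fun g => (f g - graph_expect f) ^+ 2) =
  graph_expect (fun g => f g ^+ 2) - graph_expect f ^+ 2.
Proof.
have := average_sqrB (iid nu n) (@ep_sum1 n) (@ep_bm n)
  (graph_expect f) (bmeas_family_graph f).
by rewrite -/(graph_expect f) subrr expr0n addr0.
Qed.

Lemma graph_expectE n (f : sgraph n -> R) :
  (graph_expect f)%:E = (\sum_g random_graph_pmf nu W g * (f g)%:E)%E.
Proof.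
rewrite /graph_expect /expect /average bmeas_Rintegral_sum; last first.
  by move=> g; apply: bmeasM; [exact: ep_bm|exact: bmeas_cst].
rewrite -sumEFin; apply: eq_bigr => g _.
rewrite RintegralZr//; last exact/bmeas_integrable/ep_bm.
by rewrite EFinM /Rintegral fineK//; exact: random_graph_pmf_fin_num.
Qed.

Lemma random_graphE n (A : set (sgraph n)) :
  random_graph nu W n A = (graph_expect (\1_A))%:E.
Proof. by rewrite graph_expectE; apply: eq_bigr => g _; rewrite diracE indicE. Qed.

Lemma expectation_random_graph n (f : sgraph n -> R) : (forall g, 0 <= f g) ->
  'E_(random_graph nu W n)[f]%E = (graph_expect f)%:E.
Proof.
move=> f0; rewrite unlock graph_expectE.
under eq_integral => g _.
  (* On a finite space [f] is a combination of indicators of singletons. *)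
  rewrite (_ : (f g)%:E = \sum_(h : sgraph n) (f h * \1_([set h]) g)%:E)%E; last first.
    rewrite sumEFin (bigD1 g)//= indicE classical_sets.in_set1 eqxx mulr1.
    rewrite big1 ?addr0// => h hg.
    by rewrite indicE classical_sets.in_set1 eq_sym (negbTE hg) mulr0.
  over.
rewrite ge0_integral_sum//; last first.
  by move=> h g _; rewrite lee_fin mulr_ge0.
apply: eq_bigr => h _.
under eq_integral do rewrite EFinM.
rewrite ge0_integralZl//; last by rewrite lee_fin.
rewrite integral_indic// setIT muleC; congr (_ * _)%E.
rewrite /= /random_graph (bigD1 h)//= diracE
  classical_sets.in_set1 eqxx mule1 big1 ?adde0//.
move=> g gh.
by rewrite diracE classical_sets.in_set1 (negbTE gh) mule0.
Qed.

(** Efron-Stein with [F i] the clique number of the graph without vertex [i]; the sum of squares is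
    then bounded pointwise. *)
Lemma variance_clique_number n :
  graph_expect (fun g : sgraph n => (clique_number g)%:R ^+ 2) -
    graph_expect (fun g : sgraph n => (clique_number g)%:R) ^+ 2 <=
  graph_expect (fun g : sgraph n => (clique_number g)%:R).
Proof.
have := efron_stein nu W (bmeas_family_graph (fun g : sgraph n => (clique_number g)%:R))
  (fun _ : 'I_n => bmeas_family_graph (fun g : sgraph n.-1 => (clique_number g)%:R)).
move=> /le_trans; apply; rewrite -average_sum//; last 2 first.
- exact: ep_bm.
- by move=> i g; rewrite /pullback; exact: bmeas_cst.
apply: (@le_graph_expect n (fun g => \sum_(i < n)
  ((clique_number g)%:R - (clique_number (induced (lift i) g))%:R) ^+ 2)) => g.
exact: sum_sqr_clique_number_lift.
Qed.

(** * Growth of the mean and the probability of having no [k]-clique *)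

Definition mean_clique n : R := graph_expect (fun g : sgraph n => (clique_number g)%:R).

Definition prob_clique_lt n k : R :=
  graph_expect (fun g : sgraph n => (clique_number g < k)%:R).

(** Independence of blocks, with the constant statistic 1 on the first block. *)
Lemma graph_expect_induced m n (h : sgraph n -> R) :
  graph_expect (fun g : sgraph (m + n) => h (induced (@rshift m n) g)) = graph_expect h.
Proof.
have := @expect_pull_mul _ _ _ nu W m n (fun _ _ => 1) (fun _ g => h g)
  (bmeas_family_graph (fun=> 1)) (bmeas_family_graph h).
rewrite -[X in _ = _ * X]/(graph_expect (fun=> 1)) graph_expect_cst mulr1 => eh.
apply: etrans _ eh.
by congr average; apply/funext => x; apply/funext => g; rewrite /pullback mulr1.
Qed.

Lemma le_mean_clique n n' : (n <= n')%N -> mean_clique n <= mean_clique n'.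
Proof.
move=> /subnK <-; rewrite /mean_clique -(graph_expect_induced (n' - n)).
apply: le_graph_expect => g; rewrite ler_nat clique_number_induced_le//; exact: rshift_inj.
Qed.

Lemma mean_clique_ge1 n : 1 <= mean_clique n.+1.
Proof.
rewrite -(graph_expect_cst n.+1 1); apply: le_graph_expect => g.
by rewrite (ler_nat _ 1) clique_number_gt0.
Qed.

Lemma prob_clique_lt_ge0 n k : 0 <= prob_clique_lt n k.
Proof. by rewrite -(graph_expect_cst n 0); apply: le_graph_expect. Qed.

Lemma prob_clique_lt_le1 n k : prob_clique_lt n k <= 1.
Proof.
rewrite -(graph_expect_cst n 1); apply: le_graph_expect => g.
by case: ltnP; rewrite ?ler01.
Qed.

(** A graph without a [k]-clique has none in either of two disjoint blocks, and the blocks are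
    independent. *)
Lemma prob_clique_lt_mul m n k :
  prob_clique_lt (m + n) k <= prob_clique_lt n k * prob_clique_lt m k.
Proof.
rewrite /prob_clique_lt /graph_expect -expect_pull_mul//.
rewrite [leRHS](_ : _ = graph_expect (fun g : sgraph (m + n) =>
  (clique_number (induced (@rshift m n) g) < k)%:R *
  (clique_number (induced (@lshift m n) g) < k)%:R))//.
apply: le_graph_expect => g; rewrite -natrM ler_nat mulnb.
case: ltnP => // wk; rewrite !(leq_ltn_trans _ wk)//.
- by apply: clique_number_induced_le; exact: lshift_inj.
- by apply: clique_number_induced_le; exact: rshift_inj.
Qed.

Lemma prob_clique_lt_iter m j r k :
  prob_clique_lt (j * m + r) k <= prob_clique_lt m k ^+ j.
Proof.
elim: j => [|j IH]; first by rewrite mul0n expr0 prob_clique_lt_le1.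
rewrite mulSn -addnA (le_trans (prob_clique_lt_mul _ _ _))// exprSr.
by rewrite ler_wpM2r// prob_clique_lt_ge0.
Qed.

Lemma prob_clique_lt_cvg0 m k : prob_clique_lt m k < 1 ->
  forall e, 0 < e -> exists N, forall n, (N <= n)%N -> prob_clique_lt n k <= e.
Proof.
move=> qm e e0.
have q0 := prob_clique_lt_ge0 m k.
have : (fun j => prob_clique_lt m k ^+ j) @ \oo --> (0 : R).
  by apply: cvg_expr; rewrite ger0_norm.
move=> /cvgrPdist_le/(_ _ e0)[J _ /(_ J)]/= /(_ (leqnn J)).
rewrite sub0r normrN ger0_norm ?exprn_ge0// => qJ.
exists (J * m)%N => n /subnKC <-.
exact: le_trans (prob_clique_lt_iter _ _ _ _) qJ.
Qed.

Lemma mean_clique_ge n k : k%:R * (1 - prob_clique_lt n k) <= mean_clique n.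
Proof.
rewrite -[X in X - _](graph_expect_cst n 1) -graph_expectB -graph_expectZ.
apply: le_graph_expect => g.
by case: ltnP => wk; rewrite ?subrr ?mulr0// subr0 mulr1 ler_nat.
Qed.

(** Almost surely the clique number is at most [k], so its square is at most [k] times itself. *)
Lemma sqr_clique_number_le n k : prob_clique_lt n k.+1 = 1 ->
  graph_expect (fun g : sgraph n => (clique_number g)%:R ^+ 2) <= k%:R * mean_clique n.
Proof.
move=> q1.
(* The added term is 0, yet it makes the bound hold for every graph: [n ^+ 2] covers the null event
   of a larger clique. *)
have -> : k%:R * mean_clique n =
    k%:R * mean_clique n + n%:R ^+ 2 * (1 - prob_clique_lt n k.+1).
  by rewrite q1 subrr mulr0 addr0.
rewrite -[X in X - _](graph_expect_cst n 1) -graph_expectB -!graph_expectZ.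
rewrite -graph_expectD; apply: le_graph_expect => g.
have := clique_number_le_order g; rewrite ltnS -(ler_nat R).
have w0 : 0 <= (clique_number g)%:R :> R by [].
case: leqP => [|_] /=; rewrite -?(ler_nat R) => *.
- by rewrite subrr mulr0 addr0; nra.
- by rewrite subr0 mulr1 ler_wpDl// ?mulr_ge0// lerXn2r// ?nnegrE.
Qed.

Lemma variance_clique_number_small (del : R) : 0 < del ->
  exists N, forall n, (N <= n)%N ->
    graph_expect (fun g : sgraph n => (clique_number g)%:R ^+ 2) - mean_clique n ^+ 2 <=
    del * mean_clique n ^+ 2 /\ 1 <= mean_clique n.
Proof.
move=> del0.
have ge1 n : (1 <= n)%N -> 1 <= mean_clique n by case: n => // n _; exact: mean_clique_ge1.
(* Once the mean exceeds [del^-1] it stays there by monotonicity, and the variance is at most the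
   mean, hence at most [del] times its square. *)
have [[N0 eN0]|bnd] := pselect (exists N, del^-1 <= mean_clique N).
  exists (maxn 1 N0) => n; rewrite geq_max => /andP[n1 N0n]; split; last exact: ge1.
  apply: le_trans (variance_clique_number n) _; rewrite -/(mean_clique n).
  have en : del^-1 <= mean_clique n := le_trans eN0 (le_mean_clique N0n).
  have en0 : 0 < mean_clique n := lt_le_trans ltr01 (ge1 _ n1).
  rewrite expr2 mulrA ler_pMl// -(mulfV (lt0r_neq0 del0)) ler_pM2l//.
have lt_e n : mean_clique n < del^-1.
  by rewrite ltNge; apply/negP => en; apply: bnd; exists n.
pose P k := `[< exists m, prob_clique_lt m k < 1 >].
have exP : exists k, P k.
  exists 0%N; apply/asboolP; exists 0%N; rewrite /prob_clique_lt.
  by under eq_fun do rewrite ltn0; rewrite graph_expect_cst.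
(* If the probability of no [k]-clique is at most 1/2, the mean is at least [k / 2]; as it is below
   [del^-1], [k] is below [2 * del^-1]. *)
pose B := Num.bound (2 * del^-1).
have ubP k : P k -> (k <= B)%N.
  move=> /asboolP[m qm]; have [|N qN] := prob_clique_lt_cvg0 qm (e := 2^-1).
    by rewrite invr_gt0.
  have := mean_clique_ge N k; have := qN N (leqnn N); have := lt_e N => h1 h2 h3.
  rewrite -(ler_nat R); apply: le_trans (ltW (archi_boundP _)); last first.
    by rewrite mulr_ge0// ltW// invr_gt0.
  have k0 : 0 <= k%:R :> R by [].
  nra.
case: (ex_maxnP exP ubP) => K /asboolP[m qm] maxK.
have K1gt0 : 0 < K%:R + 1 :> R by rewrite ltr_wpDl.
(* For [q <= del / (K + 1)], [K - mean <= K * q <= del <= del * mean]. The [+ 1] keeps the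
   denominator positive when [K = 0]. *)
have [|N qN] := prob_clique_lt_cvg0 qm (e := del / (K%:R + 1)); first by rewrite divr_gt0.
exists (maxn 1 N) => n; rewrite geq_max => /andP[n1 Nn]; split; last exact: ge1.
(* By maximality of [K], a larger clique has probability 0 at every order, so the second moment is
   at most [K * mean]. *)
have q1 : prob_clique_lt n K.+1 = 1.
  apply/eqP; rewrite eq_le prob_clique_lt_le1 leNgt; apply/negP => q1.
  have /maxK : P K.+1 by apply/asboolP; exists n.
  by rewrite ltnn.
have := sqr_clique_number_le q1; have := mean_clique_ge n K; have := qN n Nn.
have := ge1 n n1; rewrite ler_pdivlMr// => e1 q2 h1 h2.
have K0 : 0 <= K%:R :> R by [].
have q0 := prob_clique_lt_ge0 n K.
have : K%:R - mean_clique n <= del * mean_clique n by nra.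
nra.
Qed.

End graph_expectation.

(** * Concentration by Chebyshev's inequality *)

Theorem theorem2p2 (R : realType) (d : measure_display)
    (Omega : measurableType d) (nu : probability Omega R)
    (standard_borel_Omega : standard_borel R Omega)
    (atomless_nu : atomless nu)
    (W : graphon R Omega) (eps : R) (eps_gt0 : 0 < eps) :
  (fun n : nat =>
     random_graph nu W n
       [set g : sgraph n |
         eps < `| (clique_number g)%:R /
                  fine 'E_(random_graph nu W n)[fun g : sgraph n =>
                                                (clique_number g)%:R] - 1 |])
    @ \oo --> 0%E.
Proof.
under eq_fun do rewrite random_graphE expectation_random_graph//=.
apply: cvg_EFin; first exact: nearW.
apply/cvgrPdist_le => e e0.
(* This [del] turns the Chebyshev bound, variance over [(eps * m) ^+ 2], into [e]. *)
have [|N smallN] := variance_clique_number_small nu W (del := e * eps ^+ 2).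
  by rewrite mulr_gt0// exprn_gt0.
exists N => // n /= /smallN[]; rewrite /mean_clique.
set m := graph_expect nu W (fun g : sgraph n => (clique_number g)%:R) => var_le m1.
(* The mean vanishes at [n = 0], where the quotient takes its default value; [N] excludes that
   case. *)
have m0 : 0 < m := lt_le_trans ltr01 m1.
set A := [set g | _].
rewrite sub0r normrN ger0_norm; last first.
  by rewrite -(graph_expect_cst nu W n 0); apply: le_graph_expect => g.
have em0 : 0 < (eps * m) ^+ 2 by rewrite exprn_gt0// mulr_gt0.
(* After scaling, Chebyshev is a pointwise bound: [(eps * m) ^+ 2] times the indicator of [A] is at
   most the squared deviation from [m]. *)
rewrite -(ler_pM2l em0) -graph_expectZ (_ : _ * e = e * eps ^+ 2 * m ^+ 2); last by ring.
apply: le_trans var_le; rewrite -graph_expect_sqrB -/m; apply: le_graph_expect => g.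
rewrite indicE; case: (boolP (g \in A)) => [|_]; last by rewrite mulr0 sqr_ge0.
rewrite inE /A /= mulr1 => ltA.
rewrite -[leRHS]real_normK ?num_real// lerXn2r ?nnegrE ?mulr_ge0// ?ltW//.
rewrite (_ : _ - m = ((clique_number g)%:R / m - 1) * m); last first.
  by rewrite mulrBl mul1r divfK// gt_eqF.
by rewrite normrM (gtr0_norm m0) ltr_pM2r.
Qed.
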